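(* Let $G$ be a split comparability graph. Then $\mathcal{R}(G)=3$ if and only if $G$ contains an induced subgraph isomorphic to $F_0$ or to $F_1(5)$.
   Context: A split graph is a graph whose vertex set can be partitioned into a clique and an independent set; a comparability graph is one admitting a transitive orientation (comparability graphs are word-representable). A graph $G=(V,E)$ is represented by a word $w$ over $V$ if for all distinct $a,b\in V$, $ab\in E$ iff $a$ and $b$ alternate in $w$ (i.e. the subsequence of $w$ formed by all occurrences of $a$ and $b$ is $abab\cdots$ or $baba\cdots$). A word is $k$-uniform if each letter occurs exactly $k$ times; $\mathcal{R}(G)$ is the least $k$ such that a $k$-uniform word represents $G$. $F_0$ is the split graph with clique $\{0,c_1,c_2,c_3,c_4\}$ and independent set $\{a_1,a_2,a_3\}$ with $N(a_1)=\{0,c_2,c_3\}$, $N(a_2)=\{0,c_3,c_4\}$, $N(a_3)=\{0,c_1,c_4\}$. $F_1(5)$ is the split graph with clique $\{c_1,c_2,c_3,c_4\}$ and independent set $\{a_1,a_2,a_3,b_1,b_2\}$ with $N(b_1)=\{c_1,c_2,c_3\}$, $N(b_2)=\{c_2,c_3,c_4\}$, $N(a_i)=\{c_i,c_{i+1}\}$ for $i=1,2,3$. *)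

(* Defs.v *)
From mathcomp Require Import all_boot.
Set Implicit Arguments. Unset Strict Implicit. Unset Printing Implicit Defensive.

(* A simple graph: vertex type T : finType, edge relation E : rel T,
   assumed symmetric and irreflexive (hypotheses of the theorem). *)

Definition is_split (T : finType) (E : rel T) : Prop :=
  exists C I : {set T},
    [/\ [disjoint C & I], C :|: I = [set: T],
        {in C &, forall x y, x != y -> E x y} &
        {in I &, forall x y, ~~ E x y}].

Definition is_comparability (T : finType) (E : rel T) : Prop :=
  exists o : rel T,
    [/\ forall x y, E x y = o x y || o y x,
        forall x y, ~~ (o x y && o y x) &
        transitive o].

(* a and b alternate in w: deleting all other letters leaves abab... or baba...,
   i.e. consecutive letters of the resulting subsequence are distinct. *)
Definition alternate (T : eqType) (w : seq T) (a b : T) : bool :=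
  sorted (fun x y => x != y) [seq x <- w | (x == a) || (x == b)].

Definition represents (T : finType) (E : rel T) (w : seq T) : Prop :=
  forall a b : T, a != b -> E a b = alternate w a b.

Definition uniform (T : finType) (k : nat) (w : seq T) : Prop :=
  forall x : T, count_mem x w = k.

Definition k_representable (T : finType) (E : rel T) (k : nat) : Prop :=
  exists w : seq T, uniform k w /\ represents E w.

Definition rep_number_is (T : finType) (E : rel T) (k : nat) : Prop :=
  [/\ 0 < k, k_representable E k &
      forall j, 0 < j < k -> ~ k_representable E j].

Definition has_induced (U T : finType) (H : rel U) (E : rel T) : Prop :=
  exists f : U -> T, injective f /\ forall x y : U, E (f x) (f y) = H x y.

(* Split graph on vertices 0..n-1: vertices < k form a clique, a vertex i >= k
   is independent with neighbourhood nb i (in the clique). *)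
Definition split_rel (k : nat) (nb : nat -> seq nat) (i j : nat) : bool :=
  (i != j) && [|| (i < k) && (j < k), (k <= i) && (j \in nb i)
                | (k <= j) && (i \in nb j)].

(* F_0: 0 -> 0, c1..c4 -> 1..4, a1,a2,a3 -> 5,6,7. *)
Definition nbF0 (i : nat) : seq nat :=
  match i with 5 => [:: 0; 2; 3] | 6 => [:: 0; 3; 4] | 7 => [:: 0; 1; 4]
  | _ => [::] end.
Definition F0 : rel 'I_8 := fun x y => split_rel 5 nbF0 x y.

(* F_1(5): c1..c4 -> 0..3, a1,a2,a3 -> 4,5,6, b1,b2 -> 7,8. *)
Definition nbF1 (i : nat) : seq nat :=
  match i with 4 => [:: 0; 1] | 5 => [:: 1; 2] | 6 => [:: 2; 3]
  | 7 => [:: 0; 1; 2] | 8 => [:: 1; 2; 3] | _ => [::] end.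
Definition F1_5 : rel 'I_9 := fun x y => split_rel 4 nbF1 x y.

(* Main.v *)
Require Import Defs.
From mathcomp Require Import all_boot all_order.
From mathcomp Require Import zify.
Set Implicit Arguments. Unset Strict Implicit. Unset Printing Implicit Defensive.
Import Order.TTheory.

(* A transitive orientation numbers the clique by 0, ..., m-1 so that every
   independent vertex x misses exactly an interval [d x, u x[ of it, and all these
   intervals share a common gap. Three linear extensions then represent the graph.
   A 2-uniform word is a chord diagram: the clique letters read 0 ... m-1 0 ... m-1,
   and x is a chord from gap u x of the first copy to gap d x of the second one, or
   the other way around. Chords of different kinds never cross; two chords of the
   same kind cross exactly when one interval is a strict shift of the other, up to
   the pairs with d x = 0 and u y = m that are disjoint. So a 2-colouring of a
   conflict graph is enough; F_0 is a chain of three shifts that is not extremal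
   at both ends, and once it is excluded an obstruction to the colouring is the
   5-cycle F_1(5). Conversely F_0 and F_1(5) have no 2-uniform word, by
   exhaustive insertion of their letters. *)

(** * Enumeration of 2-uniform words; [F0] and [F1_5] have none *)

Definition insertions (x : nat) (s : seq nat) : seq (seq nat) :=
  [seq take i s ++ x :: drop i s | i <- iota 0 (size s).+1].

Lemma mem_insertions_rem x s : x \in s -> s \in insertions x (rem x s).
Proof.
move=> xs; apply/mapP; exists (index x s).
  by rewrite mem_iota add0n size_rem // (ltn_predK (m := index x s)) index_mem.
elim: s xs => //= y s IHs; rewrite inE eq_sym.
case: eqVneq => [->|_] /=; first by rewrite take0 drop0.
by move=> /IHs {1}->.
Qed.

Lemma filter_predC1_rem (x : nat) s :
  [seq y <- rem x s | y != x] = [seq y <- s | y != x].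
Proof. by elim: s => //= y s IHs; case: eqVneq => //= ->; rewrite IHs. Qed.

Lemma mem_insertions2 x s : count_mem x s = 2 ->
  s \in [seq t | r <- insertions x [seq y <- s | y != x], t <- insertions x r].
Proof.
move=> cs; have xs : x \in s by rewrite -has_pred1 has_count cs.
have c1 : count_mem x (rem x s) = 1 by rewrite count_rem xs cs /= eqxx.
have xr : x \in rem x s by rewrite -has_pred1 has_count c1.
have c0 : count_mem x (rem x (rem x s)) = 0 by rewrite count_rem xr c1 /= eqxx.
have -> : [seq y <- s | y != x] = rem x (rem x s).
  rewrite -filter_predC1_rem -filter_predC1_rem; apply/all_filterP.
  by rewrite all_predC has_count c0.
apply/allpairsPdep; exists (rem x s), s.
by split=> //; apply: mem_insertions_rem.
Qed.

(** Testing each new letter against the smaller ones, and merging the words reached by several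
    insertions, keeps the lists small enough to compute. *)
Fixpoint uniform2_words (H : rel nat) (n : nat) : seq (seq nat) :=
  if n is k.+1 then
    undup [seq s <- flatten [seq [seq t | r <- insertions k w, t <- insertions k r]
                      | w <- uniform2_words H k]
    | all (fun j => alternate s k j == H k j) (iota 0 k)]
  else [:: [::]].

Lemma alternate_filter (T : eqType) (P : pred T) w a b :
  P a -> P b -> alternate [seq x <- w | P x] a b = alternate w a b.
Proof.
move=> Pa Pb; rewrite /alternate -filter_predI; congr sorted.
by apply: eq_filter => x /=; case: eqVneq => [->|_] //=; case: eqVneq => [->|].
Qed.

Lemma alternate_map (S T : eqType) (g : S -> T) (w : seq S) a b :
    (forall x, (g x == g a) = (x == a)) -> (forall x, (g x == g b) = (x == b)) ->
  alternate (map g w) (g a) (g b) = alternate w a b.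
Proof.
move=> ga gb; rewrite /alternate filter_map sorted_map.
rewrite (eq_filter (a2 := fun x => (x == a) || (x == b))); last first.
  by move=> x /=; rewrite ga gb.
apply: (@eq_in_sorted _ [pred x | (x == a) || (x == b)]); last exact: filter_all.
by move=> x y /= _ /orP[]/eqP->; rewrite ?ga ?gb.
Qed.

(** Deleting letters does not affect the alternation of the remaining ones, so the restriction to
    letters below [n.+1] passes the test and arises from the one below [n] by inserting [n]
    twice. *)
Lemma uniform2_words_complete (H : rel nat) n (v : seq nat) :
    (forall i, i < n -> count_mem i v = 2) ->
    (forall i j, j < i < n -> alternate v i j = H i j) ->
  [seq x <- v | x < n] \in uniform2_words H n.
Proof.
elim: n => [|n IHn] cv Hv; first by rewrite (eq_filter (a2 := pred0)) ?filter_pred0.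
rewrite [uniform2_words _ _]/= mem_undup mem_filter; apply/andP; split.
  apply/allP => j; rewrite mem_iota /= => lt_jn; apply/eqP.
  by rewrite alternate_filter ?Hv //; lia.
apply/flatten_mapP; exists [seq x <- v | x < n].
  by apply: IHn => [i|i j] lt_in; [apply: cv | apply: Hv]; lia.
have -> : [seq x <- v | x < n] = [seq y <- [seq x <- v | x < n.+1] | y != n].
  by rewrite -filter_predI; apply: eq_filter => x /=; lia.
apply: mem_insertions2; rewrite count_filter -[RHS](cv n) //.
by apply: eq_count => x /=; lia.
Qed.

Lemma induced_uniform2_words (T : finType) (E : rel T) (n : nat) (H : rel nat)
    (Hn : rel 'I_n) :
    (forall i j : 'I_n, Hn i j = H i j) -> has_induced Hn E ->
  k_representable E 2 -> uniform2_words H n != [::].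
Proof.
move=> HE [f [f_inj Ef]] [w [w2 Ew]].
(* Vertices outside the image of [f] become the letter [n], which the restriction to letters below
   [n] discards. *)
pose g t := if [pick i | f i == t] is Some i then i : nat else n.
have gf t (i : 'I_n) : (g t == i) = (t == f i).
  rewrite /g; case: pickP => [j /eqP<-|/(_ i)]; first by rewrite (inj_eq f_inj).
  by rewrite eq_sym => ->; rewrite gtn_eqF.
have gfE i : g (f i) = i by apply/eqP; rewrite gf.
have := @uniform2_words_complete H n (map g w).
case: (uniform2_words H n) => // abs; suff: false by [].
apply: abs => [i lt_in | i j /andP[lt_ji lt_in]].
  rewrite count_map -[RHS](w2 (f (Ordinal lt_in))); apply: eq_count => t /=.
  by rewrite -gf.
have lt_jn := ltn_trans lt_ji lt_in.
have <- : g (f (Ordinal lt_in)) = i := gfE (Ordinal lt_in).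
have <- : g (f (Ordinal lt_jn)) = j := gfE (Ordinal lt_jn).
rewrite alternate_map => [|t|t]; rewrite ?gfE ?gf // -HE -Ef Ew //.
by rewrite (inj_eq f_inj) -val_eqE /= gtn_eqF.
Qed.

Lemma F0_not_2representable (T : finType) (E : rel T) :
  has_induced F0 E -> ~ k_representable E 2.
Proof.
move=> F0E /(induced_uniform2_words (H := split_rel 5 nbF0) _ F0E).
have -> : uniform2_words (split_rel 5 nbF0) 8 = [::] by vm_compute.
by move=> /(_ (fun _ _ => erefl)).
Qed.

Lemma F1_5_not_2representable (T : finType) (E : rel T) :
  has_induced F1_5 E -> ~ k_representable E 2.
Proof.
move=> F1E /(induced_uniform2_words (H := split_rel 4 nbF1) _ F1E).
have -> : uniform2_words (split_rel 4 nbF1) 9 = [::] by vm_compute.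
by move=> /(_ (fun _ _ => erefl)).
Qed.

(** * Words read off from ordered keys *)

Local Open Scope order_scope.

Definition keyed_word disp (K : orderType disp) (T J : finType) (key : T -> J -> K) :
    seq T :=
  [seq p.1 | p <- sort (relpre (fun p => key p.1 p.2) <=%O) (enum {: T * J})].

Lemma keyed_word_uniform disp (K : orderType disp) (T J : finType)
  (key : T -> J -> K) : uniform #|J| (keyed_word key).
Proof.
move=> x; rewrite count_map (permP (permEl (perm_sort _ _))).
rewrite -size_filter -[RHS]mul1n -(card1 x) -cardX cardE {1}/enum_mem -filter_predI.
by congr size; apply: eq_filter => -[y j]; rewrite !inE /= !andbT.
Qed.

(** Sorting commutes with filtering, and strictly increasing keys leave only one sorted arrangement
    of the selected occurrences. Any such list [s] is therefore the wanted subsequence. *)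
Lemma keyed_word_restr disp (K : orderType disp) (T J : finType) (key : T -> J -> K)
    (P : pred T) (s : seq (T * J)) :
    sorted <%O [seq key p.1 p.2 | p <- s] -> (forall p, (p \in s) = P p.1) ->
  [seq x <- keyed_word key | P x] = [seq p.1 | p <- s].
Proof.
set key' := fun p => _; move=> s_lt sP; rewrite filter_map; congr map.
have key'_inj : {in s &, injective key'}.
  move=> p q ps qs eq_pq; rewrite -(nth_index p ps) -(nth_index p qs).
  congr nth; apply/eqP; rewrite -(nth_uniq (key' p) _ _ (lt_sorted_uniq s_lt));
    by rewrite ?size_map ?index_mem // !(nth_map p) ?index_mem // !nth_index // eq_pq.
have tot : total (relpre key' <=%O) by move=> p q; apply: le_total.
have trans : transitive (relpre key' <=%O) by move=> p q r; apply: le_trans.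
rewrite filter_sort //; apply: (sorted_eq_in (leT := relpre key' <=%O)).
- by move=> p q r _ _ _; apply: le_trans.
- move=> p q; rewrite !mem_sort !mem_filter /= -!sP => /andP[ps _] /andP[qs _].
  by move=> /le_anti; apply: key'_inj.
- exact: sort_sorted.
- by rewrite -sorted_map; case/andP: (lt_sorted_is_uniq_le s_lt).
rewrite perm_sort; apply: uniq_perm.
- by rewrite filter_uniq ?enum_uniq.
- exact: map_uniq (lt_sorted_uniq s_lt).
by move=> p; rewrite mem_filter mem_enum andbT /= sP.
Qed.

Lemma alternateC (T : eqType) (w : seq T) a b : alternate w a b = alternate w b a.
Proof. by rewrite /alternate; congr sorted; apply: eq_filter => x; rewrite orbC. Qed.

Lemma alternate_keyed2 disp (K : orderType disp) (T : finType) (key : T -> bool -> K)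
    a b : a != b -> key a false < key a true -> key b false < key b true ->
    (forall i j, key a i != key b j) ->
  alternate (keyed_word key) a b =
    [&& key a false < key b false, key b false < key a true & key a true < key b true]
  || [&& key b false < key a false, key a false < key b true & key b true < key a true].
Proof.
move=> neq_ab; wlog lt_ab : a b neq_ab / key a false < key b false.
  move=> W a01 b01 key_ab; have := key_ab false false.
  rewrite neq_lt => /orP[lt_ab|lt_ba]; first exact: W.
  by rewrite alternateC W 1?orbC 1?eq_sym // => i j; rewrite eq_sym.
move=> a01 b01 key_ab.
have W s : sorted <%O [seq key p.1 p.2 | p <- s] ->
    s =i [:: (a, false); (a, true); (b, false); (b, true)] ->
    alternate (keyed_word key) a b = sorted (fun x y => x != y) [seq p.1 | p <- s].
  move=> s_lt sE; rewrite /alternate (keyed_word_restr s_lt) // => -[x j].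
  rewrite sE !inE !xpair_eqE /=.
  by case: (x == a); case: (x == b); case: j.
rewrite lt_ab /= (ltNge (key b false) (key a false)) (ltW lt_ab) /= orbF.
have [lt_ba|lt_ab'|eq_ab] := ltgtP (key b false) (key a true).
- have [lt_a1b1|lt_b1a1|eq_ab] := ltgtP (key a true) (key b true).
  + rewrite (W [:: (a, false); (b, false); (a, true); (b, true)]) /=.
    * by rewrite [b == a]eq_sym neq_ab.
    * by rewrite lt_ab lt_ba lt_a1b1.
    by move=> p; rewrite !inE; do 4!case: (p == _).
  + rewrite (W [:: (a, false); (b, false); (b, true); (a, true)]) /=.
    * by rewrite eqxx andbF.
    * by rewrite lt_ab b01 lt_b1a1.
    by move=> p; rewrite !inE; do 4!case: (p == _).
  by have := key_ab true true; rewrite eq_ab eqxx.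
- rewrite (W [:: (a, false); (a, true); (b, false); (b, true)]) /= ?eqxx //.
  by rewrite a01 lt_ab' b01.
by have := key_ab true false; rewrite eq_ab eqxx.
Qed.

(** The last hypothesis makes the word a concatenation of three permutations; two letters alternate
    when all three order them alike. *)
Lemma alternate_keyed3 disp (K : orderType disp) (T : finType) (key : T -> nat -> K)
    a b : a != b -> (forall i, key a i != key b i) ->
    (forall x y i j, (i < j < 3)%N -> key x i < key y j) ->
  alternate (keyed_word (fun x (i : 'I_3) => key x i)) a b =
    ((key a 0 < key b 0) == (key a 1 < key b 1)) &&
    ((key a 1 < key b 1) == (key a 2 < key b 2)).
Proof.
move=> neq_ab key_ab key_lt.
pose block (i : 'I_3) :=
  if key a i < key b i then [:: (a, i); (b, i)] else [:: (b, i); (a, i)].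
have key_ba i : (key b i < key a i) = ~~ (key a i < key b i).
  by rewrite -leNgt le_eqVlt eq_sym (negPf (key_ab i)).
pose o0 : 'I_3 := @Ordinal 3 0 isT; pose o1 : 'I_3 := @Ordinal 3 1 isT.
pose o2 : 'I_3 := @Ordinal 3 2 isT.
have oP (i : 'I_3) : [\/ i = o0, i = o1 | i = o2].
  by case: i => [[|[|[|]]]] lt_i3 //; [apply: Or31 | apply: Or32 | apply: Or33];
    apply: val_inj.
rewrite /alternate (keyed_word_restr (s := block o0 ++ block o1 ++ block o2)).
- rewrite /block /=; case: (key a 0 < key b 0); case: (key a 1 < key b 1);
    by case: (key a 2 < key b 2); rewrite /= ?eqxx ?[b == a]eq_sym ?neq_ab ?andbF.
- rewrite /block /=.
  by case lt0: (key a 0 < key b 0); case lt1: (key a 1 < key b 1);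
    case lt2: (key a 2 < key b 2); rewrite /= ?key_ba ?lt0 ?lt1 ?lt2 ?key_lt.
move=> [x i]; rewrite !mem_cat /=.
have blockE j : ((x, i) \in block j) = ((x == a) || (x == b)) && (i == j).
  rewrite /block; case: ifP => _; rewrite !inE !xpair_eqE; first by rewrite andb_orl.
  by rewrite orbC andb_orl.
by rewrite !blockE -!andb_orr; case: (oP i) => ->; rewrite ?eqxx ?orbT andbT.
Qed.

(** In the keys built from it, clique letters get odd positions and gaps even ones. The last
    component separates independent letters that are still tied; reversing it in another copy keeps
    them from alternating. *)
Definition lexkey (a b c e : nat) : nat *l (nat *l (nat *l nat)) := (a, (b, (c, e))).

Lemma lt_lexkey a b c e a' b' c' e' :
  (lexkey a b c e < lexkey a' b' c' e') =
  ((a < a') || (a == a') && ((b < b') || (b == b') &&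
     ((c < c') || (c == c') && (e < e'))))%N.
Proof. rewrite /lexkey !ltxi_pair !leEnat ltEnat /=; lia. Qed.

Lemma eq_lexkey a b c e a' b' c' e' :
  (lexkey a b c e == lexkey a' b' c' e') = [&& a == a', b == b', c == c' & e == e'].
Proof. by []. Qed.
Close Scope order_scope.

(** * Two-colouring the conflicts between shifted intervals *)

Section Colourings.
Context (T : finType) (d u : T -> nat) (m : nat).
Context (um : forall x, u x <= m).

(* When the neighbourhood of [x] is the clique without its interval [d x, u x[,
   two such sets are incomparable for inclusion iff one interval is a strict
   shift of the other. *)
Definition shifted x y := (d x < d y) && (u x < u y).

(* The chords of a colour class must be pairwise nested or disjoint; the
   last clause allows the disjoint pairs, the first one excludes isolated
   vertices from the class [kap]. *)
Definition admissible (kap : pred T) :=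
  [/\ forall x, kap x -> (0 < d x) || (u x < m),
      forall x y, shifted x y -> kap x || kap y &
      forall x y, shifted x y -> kap x -> kap y -> d x = 0 /\ u y = m].

(** The shifts [p] to [x], [x] to [q], [z] to [q], [z] to [y] and [p] to [y] form a 5-cycle, and
    none of them satisfies the exception in [admissible]. *)
Definition F1_config p q x y z :=
  [/\ d p = 0, u q = m, 0 < d x <= d z, d z < d q <= d y
    & (u z <= u p < u y) && (u y <= u x < m)].

(** Without chains of two shifts, the upper ends of shifts form a class. Otherwise the class takes
    every vertex extremal at exactly one end, and the mixed vertices that lie above a mixed one or,
    dually, below one. If both choices fail, the failures supply [y] and [z]. *)
Lemma admissible_or_F1_config :
    (forall x y z, shifted x y -> shifted y z -> d x = 0 /\ u z = m) ->
  (exists kap, admissible kap) \/ (exists p q x y z, F1_config p q x y z).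
Proof.
move=> chain3; pose mixed x := (0 < d x) && (u x < m).
case: (boolP [exists w, exists x, exists y, shifted w x && shifted x y]); last first.
  move=> no3; left; exists (fun x => [exists w, shifted w x]); split.
  - by move=> x /existsP[w]; rewrite /shifted; lia.
  - by move=> x y xy; apply/orP; right; apply/existsP; exists x.
  move=> x y xy /existsP[w wx] _; case/negP: no3.
  by apply/existsP; exists w; apply/existsP; exists x; apply/existsP; exists y; apply/andP.
move=> /existsP[p /existsP[x /existsP[q /andP[px xq]]]].
(* [p] and [q] are not mixed; a colouring exists unless among the mixed vertices
   some [y] lies above such a [p] but below no such [q], and some [z] conversely. *)
have [p0 qm] := chain3 _ _ _ px xq.
case: (boolP [forall p, forall y, [&& d p == 0, mixed y & shifted p y] ==>
              [exists q, (u q == m) && shifted y q]]) => [/forallP YZ | ].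
  left; exists (fun v => if mixed v then [exists w, mixed w && shifted w v]
                     else (0 < d v) || (u v < m)).
  split=> [v | v v' vv' | v v' vv'].
  - by case: ifP => //; rewrite /mixed => /andP[->].
  - case: ifP => mv; last by move: vv' mv; rewrite /mixed /shifted; have := um v'; lia.
    case: ifP => mv'; last by move: vv' mv'; rewrite /mixed /shifted; lia.
    by apply/orP; right; apply/existsP; exists v; rewrite mv.
  case: ifP => mv.
    move=> /existsP[w /andP[mw wv]] _; have [w0 _] := chain3 _ _ _ wv vv'.
    by move: mw; rewrite /mixed w0.
  have v0 : d v = 0 by move: vv' mv; rewrite /mixed /shifted; have := um v'; lia.
  move=> _; case: ifP => mv'; last first.
    by move: vv' mv'; rewrite /mixed /shifted; have := um v'; lia.
  move=> /existsP[w /andP[mw wv']].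
  have /forallP/(_ v') := YZ v; rewrite v0 mv' vv' /=.
  move=> /existsP[q' /andP[_ v'q']]; have [w0 _] := chain3 _ _ _ wv' v'q'.
  by move: mw; rewrite /mixed w0.
move=> /forallPn[p1 /forallPn[y]]; rewrite negb_imply negb_exists.
move=> /andP[/and3P[/eqP p10 my p1y] /forallP yZ].
case: (boolP [forall q, forall z, [&& u q == m, mixed z & shifted z q] ==>
              [exists p, (d p == 0) && shifted p z]]) => [/forallP ZY | ].
  left; exists (fun v => if mixed v then [exists w, mixed w && shifted v w]
                     else (0 < d v) || (u v < m)).
  split=> [v | v v' vv' | v v' vv'].
  - by case: ifP => //; rewrite /mixed => /andP[->].
  - case: ifP => mv; last by move: vv' mv; rewrite /mixed /shifted; have := um v'; lia.
    case: ifP => mv'; last by move: vv' mv'; rewrite /mixed /shifted; lia.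
    by apply/orP; left; apply/existsP; exists v'; rewrite mv'.
  case: (ifP (mixed v')) => mv'.
    move=> _ /existsP[w /andP[mw v'w]]; have [_ wm] := chain3 _ _ _ vv' v'w.
    by move: mw; rewrite /mixed wm; lia.
  have v'm : u v' = m by move: vv' mv'; rewrite /mixed /shifted; have := um v'; lia.
  case: ifP => mv; last by move: vv' mv; rewrite /mixed /shifted; have := um v'; lia.
  move=> /existsP[w /andP[mw vw]] _.
  have /forallP/(_ v) := ZY v'; rewrite v'm mv vv' eqxx /=.
  move=> /existsP[p' /andP[_ p'v]]; have [_ wm] := chain3 _ _ _ p'v vw.
  by move: mw; rewrite /mixed wm; lia.
move=> /forallPn[q1 /forallPn[z]]; rewrite negb_imply negb_exists.
move=> /andP[/and3P[/eqP q1m mz zq1] /forallP zY]; right.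
(* The candidate with the smaller [u] is shifted to both [x] and [y], since [d] vanishes on both
   candidates; dually for [q']. *)
pose p' := if u p < u p1 then p else p1; pose q' := if d q1 < d q then q else q1.
have [p'0 p'x p'y] : [/\ d p' = 0, shifted p' x & shifted p' y].
  rewrite /p'; case: ltnP => ltp; split=> //;
    by move: px xq p1y my; rewrite /shifted /mixed; lia.
have [q'm xq' zq'] : [/\ u q' = m, shifted x q' & shifted z q'].
  rewrite /q'; case: ltnP => ltq; split=> //;
    by move: px xq zq1 mz; rewrite /shifted /mixed; have := um q; have := um q1; lia.
exists p', q', x, y, z.
have := yZ q'; have := zY p'; rewrite p'0 q'm !eqxx /=.
have Nxy : ~~ shifted x y.
  by apply/negP => xy; have := chain3 _ _ _ p'x xy; move: my; rewrite /mixed; lia.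
have Nzx : ~~ shifted z x.
  by apply/negP => zx; have := chain3 _ _ _ zx xq'; move: mz; rewrite /mixed; lia.
move: my mz p'x p'y xq' zq' Nxy Nzx; rewrite /F1_config /shifted /mixed.
by move=> *; split; lia.
Qed.

End Colourings.

(** * Split graphs and their interval models *)

(** Gathering the cross adjacencies in one boolean table turns a concrete embedding into an equality
    of lists. *)
Lemma has_induced_split (T : finType) (E : rel T) (nb : nat -> seq nat)
    (cs vs : seq T) (n : nat) (x0 : T) :
    symmetric E -> uniq (cs ++ vs) -> n = size cs + size vs ->
    (forall j, all (gtn (size cs)) (nb j)) ->
    {in cs &, forall c c', E c c' = (c != c')} -> {in vs &, forall v v', ~~ E v v'} ->
    [seq [seq E c v | v <- vs] | c <- cs] =
      [seq [seq i \in nb j | j <- iota (size cs) (size vs)] | i <- iota 0 (size cs)] ->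
  has_induced (fun i j : 'I_n => split_rel (size cs) nb i j) E.
Proof.
move=> Esym s_uniq -> nb_lt Ecc Evv Ecv; set k := size cs in nb_lt Ecv *.
exists (fun i : 'I__ => nth x0 (cs ++ vs) i); split=> [i j /eqP | ].
  by rewrite nth_uniq ?size_cat // => /eqP/val_inj.
have cross i j : i < k -> k <= j < k + size vs ->
    E (nth x0 cs i) (nth x0 vs (j - k)) = (i \in nb j).
  move=> lt_ik lt_j; have := congr1 (nth [::] ^~ i) Ecv.
  rewrite (nth_map x0) // (nth_map 0) ?size_iota // => /(congr1 (nth false ^~ (j - k))).
  rewrite (nth_map x0); last by lia.
  rewrite (nth_map 0) ?size_iota; last by lia.
  by rewrite !nth_iota ?add0n; try lia; rewrite subnKC //; lia.
move=> i j; have := ltn_ord i; have := ltn_ord j.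
move: (nat_of_ord i) (nat_of_ord j) => {}i {}j lt_j lt_i; rewrite /split_rel !nth_cat -/k.
case: (ltnP i k) => ik; case: (ltnP j k) => jk; rewrite /= ?orbF ?andbT ?andbF.
- by rewrite Ecc ?mem_nth // nth_uniq //; move: s_uniq; rewrite cat_uniq => /andP[].
- by rewrite cross ?jk //; have -> : i != j by lia.
- by rewrite Esym cross ?ik //; have -> : i != j by lia.
have nbF i' j' : k <= i' -> (i' \in nb j') = false.
  by move=> ki; apply/negP => /(allP (nb_lt j')) /=; lia.
by rewrite !nbF // !andbF (negPf (Evv _ _ _ _)) // mem_nth // ltn_subLR.
Qed.

(* [rk] numbers the clique along the transitive orientation; an independent
   vertex is adjacent to the clique vertices of rank below [d x] or at least
   [u x]. On the clique [d] and [u] have the values of an isolated vertex, so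
   that clique vertices are never [shifted]. *)
Record split_model (T : finType) (E : rel T) (C : {set T}) (rk d u : T -> nat) : Prop :=
  SplitModel {
    model_sym : symmetric E;
    model_rk_lt : forall c, c \in C -> rk c < #|C|;
    model_rk_inj : {in C &, injective rk};
    model_clique : {in C &, forall c c', E c c' = (c != c')};
    model_indep : forall x y, x \notin C -> y \notin C -> ~~ E x y;
    model_cross : forall c x, c \in C -> x \notin C ->
      E c x = (rk c < d x) || (u x <= rk c);
    model_junk : forall c, c \in C -> d c = 0 /\ u c = #|C|;
    model_le : forall x y, d x <= u y;
    model_u_le : forall x, u x <= #|C| }.

Lemma ltn_enum_rank (T : finType) (x : T) : enum_rank x < #|T|.
Proof. exact: ltn_ord. Qed.

Lemma represents_half (T : finType) (E : rel T) (C : {set T}) (w : seq T) :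
    symmetric E ->
    (forall a b, a != b -> (b \in C) ==> (a \in C) -> E a b = alternate w a b) ->
  represents E w.
Proof.
move=> Esym Ew a b neq_ab; case bC: (b \in C); last by rewrite Ew ?bC.
by rewrite Esym alternateC Ew ?bC ?implybT // eq_sym.
Qed.

(** * A 3-uniform word, and a 2-uniform word from a colouring *)

Section Words.
Context (T : finType) (E : rel T) (C : {set T}) (rk d u : T -> nat).
Context (model : split_model E C rk d u).

Lemma split_model_3representable : k_representable E 3.
Proof.
have [Esym rk_lt rk_inj ECC EII ECI _ du um] := model.
(* Two linear extensions with the independent vertices as low, resp. as high, as
   possible, and a third one reversing their order at a common gap. *)
pose k := \max_(x | x \notin C) d x.
have dk x : x \notin C -> d x <= k by move=> xI; apply: leq_bigmax_cond.
have ku x : x \notin C -> k <= u x.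
  by move=> xI; apply/bigmax_leqP => y _; apply: du.
pose key x i :=
  if x \in C then lexkey i (2 * rk x).+1 0 0 else
  match i with
  | 0 => lexkey i (2 * d x) 0 (enum_rank x)
  | 1 => lexkey i (2 * u x) 0 (enum_rank x)
  | _ => lexkey i (2 * k) (#|C| - d x) (#|T| - enum_rank x)
  end.
exists (keyed_word (fun x (i : 'I_3) => key x i)); split.
  by have := keyed_word_uniform (fun x (i : 'I_3) => key x i); rewrite card_ord.
apply: (represents_half (C := C)) => // a b neq_ab /implyP abC.
have ltaN := ltn_enum_rank a; have ltbN := ltn_enum_rank b.
have neq_rank : enum_rank a != enum_rank b :> nat.
  by rewrite (inj_eq val_inj) (inj_eq enum_rank_inj).
have key_neq i : key a i != key b i.
  rewrite /key; case aC: (a \in C); case bC: (b \in C).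
  - have : rk a != rk b by apply: contraNneq neq_ab => /rk_inj->.
    rewrite eq_lexkey; lia.
  - case: i => [|[|i]]; rewrite eq_lexkey; lia.
  - case: i => [|[|i]]; rewrite eq_lexkey; lia.
  case: i => [|[|i]]; rewrite eq_lexkey; lia.
rewrite alternate_keyed3 // => [|x y i j ltij]; last first.
  rewrite /key; case: ifP => _; case: ifP => _;
   move: i j ltij => [|[|i]] [|[|j]] ltij; rewrite lt_lexkey; lia.
rewrite /key; case aC: (a \in C); case bC: (b \in C).
- rewrite ECC // neq_ab !lt_lexkey; lia.
- rewrite ECI ?bC // !lt_lexkey.
  have := du b b; have := dk b; have := ku b; rewrite bC => /(_ isT) kub /(_ isT) dkb.
  by lia.
- by rewrite abC in aC.
rewrite !lt_lexkey (negPf (EII _ _ _ _)) ?aC ?bC //.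
have := du a b; have := du b a; have := du a a; have := du b b.
by have := um a; have := um b; lia.
Qed.

(* The clique letters read [rk = 0 .. m-1] twice; [kap x] tells whether [x]
   occurs at gap [u x] of the first copy and gap [d x] of the second one, or the
   other way around. The last three components of the keys order the letters
   of a common gap so that non-adjacent chords do not cross; the order of the
   second component matters because gap [m] of the first copy is gap [0] of the
   second one. *)
Lemma split_model_2representable (kap : pred T) :
  admissible d u #|C| kap -> k_representable E 2.
Proof.
move=> [kap_iso kap_or kap_and].
have [Esym rk_lt rk_inj ECC EII ECI _ du um] := model.
pose m := #|C|.
pose key x (j : bool) :=
  if x \in C then lexkey (2 * (j * m + rk x)).+1 0 0 0 else
  match kap x, j with
  | true, false => lexkey (2 * u x) 2 (m - d x) (enum_rank x)
  | true, true => lexkey (2 * (m + d x)) 1 (m - u x) (#|T| - enum_rank x)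
  | false, false => lexkey (2 * d x) 0 (m - u x) (enum_rank x)
  | false, true => lexkey (2 * (m + u x)) 3 (m - d x) (#|T| - enum_rank x)
  end.
exists (keyed_word key); split; first by have := keyed_word_uniform key; rewrite card_bool.
have key_lt x : (key x false < key x true)%O.
  rewrite /key; case xC: (x \in C).
    by have := rk_lt _ xC; rewrite lt_lexkey -/m; lia.
  (* An isolated vertex in [kap] would have both occurrences at gap [m], in the wrong order because
     of the second components 2 and 1. *)
  have := kap_iso x; have := du x x; have := um x; rewrite -/m => ? ?.
  by case: (kap x) => [/(_ isT)|_]; rewrite lt_lexkey; lia.
apply: (represents_half (C := C)) => // a b neq_ab /implyP abC.
have ltaN := ltn_enum_rank a; have ltbN := ltn_enum_rank b.
have neq_rank : enum_rank a != enum_rank b :> nat.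
  by rewrite (inj_eq val_inj) (inj_eq enum_rank_inj).
have key_neq i j : key a i != key b j.
  rewrite /key; case aC: (a \in C); case bC: (b \in C).
  - have : rk a != rk b by apply: contraNneq neq_ab => /rk_inj->.
    have := rk_lt _ aC; have := rk_lt _ bC; rewrite -/m.
    case: i; case: j; rewrite eq_lexkey; lia.
  - case: j; case: (kap b); rewrite eq_lexkey; lia.
  - case: i; case: (kap a); rewrite eq_lexkey; lia.
  case: i; case: j; case: (kap a); case: (kap b); rewrite eq_lexkey; lia.
rewrite alternate_keyed2 //.
rewrite /key; case aC: (a \in C); case bC: (b \in C).
- have := rk_lt _ aC; have := rk_lt _ bC; rewrite -/m.
  have : rk a != rk b by apply: contraNneq neq_ab => /rk_inj->.
  rewrite ECC // neq_ab !lt_lexkey; lia.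
- rewrite ECI ?bC //; have := rk_lt _ aC.
  have := um b; have := du b b; rewrite -/m => ? ?.
  by case: (kap b); rewrite !lt_lexkey; lia.
- by rewrite abC in aC.
rewrite (negPf (EII _ _ _ _)) ?aC ?bC //.
have := du a b; have := du b a; have := du a a; have := du b b.
have := um a; have := um b; have := kap_iso a; have := kap_iso b.
have := kap_or a b; have := kap_or b a.
have := kap_and a b; have := kap_and b a; rewrite /shifted -/m.
by case: (kap a); case: (kap b); rewrite !lt_lexkey /=; lia.
Qed.
End Words.

(** * The interval model of a transitive orientation *)

(** The orientation is linear on the clique. By transitivity the in-neighbours of an independent
    vertex form an initial segment and its out-neighbours a final one. A clique vertex going into
    [x] and coming from [y] would force an edge between [y] and [x], whence the common gap. *)
Lemma split_comparability_model (T : finType) (E : rel T) :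
    symmetric E -> irreflexive E -> is_split E -> is_comparability E ->
  exists C rk d u, split_model E C rk d u.
Proof.
move=> Esym Eirr [C [I [disjCI /setP CI clique indep]]] [o [Eo oN otr]].
have oirr x : o x x = false by have := oN x x; rewrite andbb => /negbTE.
have oE x y : o x y -> E x y by rewrite Eo => ->.
have CIP x : x \notin C -> x \in I.
  by have := CI x; rewrite !inE => /orP[->|].
have indepC x y : x \notin C -> y \notin C -> ~~ E x y.
  by move=> /CIP xI /CIP yI; apply: indep.
have Ctot c c' : c \in C -> c' \in C -> c != c' -> o c c' || o c' c.
  by move=> cC c'C neq; rewrite -Eo; apply: clique.
pose rk c := #|[set c' in C | o c' c]|.
pose d x := if x \in C then 0 else #|[set c in C | o c x]|.
pose u x := if x \in C then #|C| else #|[set c in C | ~~ o x c]|.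
have rk_mono c c' : c \in C -> c' \in C -> o c c' -> rk c < rk c'.
  move=> cC c'C cc'; apply/proper_card/properP; split.
    by apply/subsetP => b; rewrite !inE => /andP[-> /otr]; apply.
  by exists c; rewrite !inE ?cC ?cc' ?oirr ?andbF.
have dP c x : c \in C -> x \notin C -> o c x = (rk c < d x).
  move=> cC xI; rewrite /d (negPf xI); apply/idP/idP => [cx|].
    apply/proper_card/properP; split.
      by apply/subsetP => b; rewrite !inE => /andP[-> /otr]; apply.
    by exists c; rewrite !inE cC ?cx ?oirr ?andbF.
  apply: contraLR => Ncx; rewrite -leqNgt; apply/subset_leq_card/subsetP => b.
  rewrite !inE => /andP[bC bx]; rewrite bC /=.
  have neq_bc : b != c by apply: contraNneq Ncx => <-.
  by case/orP: (Ctot _ _ bC cC neq_bc) => // cb; rewrite (otr _ _ _ cb bx) in Ncx.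
have uP c x : c \in C -> x \notin C -> o x c = (u x <= rk c).
  move=> cC xI; rewrite /u (negPf xI); apply/idP/idP => [xc|].
    apply/subset_leq_card/subsetP => b; rewrite !inE => /andP[bC Nxb]; rewrite bC /=.
    have neq_bc : b != c by apply: contraNneq Nxb => ->.
    by case/orP: (Ctot _ _ bC cC neq_bc) => // cb; rewrite (otr _ _ _ xc cb) in Nxb.
  apply: contraLR => Nxc; rewrite -ltnNge; apply/proper_card/properP; split.
    apply/subsetP => b; rewrite !inE => /andP[-> bc] /=.
    by apply: contra Nxc => xb; apply: otr bc.
  by exists c; rewrite !inE cC ?Nxc ?oirr ?andbF.
have rk_lt c : c \in C -> rk c < #|C|.
  move=> cC; apply/proper_card/properP; split.
    by apply/subsetP => b; rewrite inE => /andP[].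
  by exists c; rewrite // !inE oirr andbF.
have u_le x : u x <= #|C|.
  rewrite /u; case: ifP => // _; apply/subset_leq_card/subsetP => b.
  by rewrite inE => /andP[].
exists C, rk, d, u; split=> //.
- move=> c c' cC c'C rk_eq; apply/eqP; apply: contraT => /(Ctot _ _ cC c'C).
  by case/orP => /rk_mono; rewrite rk_eq ltnn => /(_ _ _); rewrite cC c'C => /(_ isT isT).
- by move=> c c' cC c'C; case: eqVneq => [->|/clique->]; rewrite ?Eirr.
- by move=> c x cC xI; rewrite Eo dP // uP.
- by move=> c cC; rewrite /d /u cC.
move=> x y; rewrite /d; case: ifP => // xI; rewrite /u; case: ifP => yI.
  by apply/subset_leq_card/subsetP => b; rewrite inE => /andP[].
apply/subset_leq_card/subsetP => b; rewrite !inE => /andP[-> bx] /=.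
apply/negP => yb; have := indepC y x; rewrite xI yI => /(_ isT isT)/negP; apply.
by apply/oE; apply: otr bx.
Qed.

(** * Finding [F0] and [F1_5] in a model *)

Section Obstructions.
Context (T : finType) (E : rel T) (C : {set T}) (rk d u : T -> nat).
Context (model : split_model E C rk d u).

Lemma model_rk_surj n : n < #|C| -> exists2 c, c \in C & rk c = n.
Proof.
move=> lt_n; pose s := [seq rk c | c <- enum C].
have s_uniq : uniq s.
  rewrite map_inj_in_uniq ?enum_uniq // => c c'; rewrite !mem_enum.
  exact: (model_rk_inj model).
have s_sub : {subset s <= iota 0 #|C|}.
  by move=> _ /mapP[c cC ->]; rewrite mem_enum in cC; rewrite mem_iota (model_rk_lt model).
have [|_ sE] := uniq_min_size s_uniq s_sub; first by rewrite size_iota size_map -cardE.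
have /mapP[c cC ->] : n \in s by rewrite sE mem_iota.
by exists c; rewrite mem_enum in cC.
Qed.

Lemma shifted_indep x y : shifted d u x y -> x \notin C /\ y \notin C.
Proof.
rewrite /shifted => /andP[dxy uxy]; split; apply/negP => /(model_junk model)[d0 um].
  by have := model_u_le model y; lia.
by lia.
Qed.

Lemma model_induced (x0 : T) nb (cs vs : seq T) :
    uniq [seq rk c | c <- cs] -> all (mem C) cs ->
    uniq vs -> all [predC C] vs ->
    (forall j, all (gtn (size cs)) (nb j)) ->
    [seq [seq (rk c < d v) || (u v <= rk c) | v <- vs] | c <- cs] =
      [seq [seq i \in nb j | j <- iota (size cs) (size vs)] | i <- iota 0 (size cs)] ->
  has_induced (fun i j : 'I_(size cs + size vs) => split_rel (size cs) nb i j) E.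
Proof.
move=> cs_uniq /allP csC vs_uniq /allP vsI nb_lt adj.
apply: has_induced_split x0 _ _ _ _ _ _ _ => //.
- exact: model_sym model.
- rewrite cat_uniq (map_uniq cs_uniq) vs_uniq andbT /=.
  by apply/hasPn => v /vsI; apply: contra => /csC.
- by move=> c c' /csC cC /csC c'C; apply: (model_clique model).
- by move=> v v' /vsI vI /vsI v'I; apply: (model_indep model).
rewrite -adj; apply/eq_in_map => c /csC cC; apply/eq_in_map => v /vsI vI.
exact: (model_cross model).
Qed.

Lemma model_F0 x y z : shifted d u x y -> shifted d u y z ->
  (0 < d x) || (u z < #|C|) -> has_induced F0 E.
Proof.
move=> xy yz; have [xI yI] := shifted_indep xy; have [_ zI] := shifted_indep yz.
move: xy yz; rewrite /shifted => /andP[dxy uxy] /andP[dyz uyz] dxuz.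
have := model_le model z x; have := model_u_le model z => uz dzux.
(* The vertex 0 of [F0]: rank 0 lies below all three intervals when [0 < d x], and rank [u z] lies
   above them otherwise. *)
have [c0 c0C c0rk] : exists2 c, c \in C & rk c < d x \/ u z <= rk c.
  case/orP: dxuz => [dx|uzm].
    by have [|c cC ck] := @model_rk_surj 0; [lia | exists c => //; left; rewrite ck].
  by have [|c cC ck] := @model_rk_surj (u z); [lia | exists c => //; right; rewrite ck].
have [|c1 c1C c1rk] := @model_rk_surj (u x); first by lia.
have [|c2 c2C c2rk] := @model_rk_surj (d y); first by lia.
have [|c3 c3C c3rk] := @model_rk_surj (d x); first by lia.
have [|c4 c4C c4rk] := @model_rk_surj (u y); first by lia.
(* The ends satisfy [d x < d y < d z <= u x < u y < u z]; each of [c1] to [c4] sits at an end, which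
   decides its adjacencies. *)
apply: (@model_induced x nbF0 [:: c0; c1; c2; c3; c4] [:: z; y; x]).
- by rewrite /= !inE !negb_or c1rk c2rk c3rk c4rk; lia.
- by rewrite /= c0C c1C c2C c3C c4C.
- rewrite /= !inE !negb_or !andbT -andbA; apply/and3P.
  by split; apply: contraTneq isT => E0; move: dxy dyz; rewrite E0; lia.
- by rewrite /= xI yI zI.
- by do 8?case=> //.
rewrite /= c1rk c2rk c3rk c4rk !inE /=.
have := model_le model y x; have := model_le model z y; have := model_le model y y.
have := model_le model x z; have := model_le model x x; have := model_le model z z.
clear - dxy uxy dyz uyz uz dzux c0rk; move=> *.
by congr [:: [:: _; _; _]; [:: _; _; _];
  [:: _; _; _]; [:: _; _; _]; [:: _; _; _]]; lia.
Qed.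

Lemma model_F1_5 p q x y z : F1_config d u #|C| p q x y z -> has_induced F1_5 E.
Proof.
move=> [p0 qm xz zqy /andP[zpy yxm]].
have [dyp dqp dzx] := And3 (model_le model y p) (model_le model q p) (model_le model z x).
have [dyz dqz dxp] := And3 (model_le model y z) (model_le model q z) (model_le model x p).
have dyx := model_le model y x.
have [|c0 c0C c0rk] := @model_rk_surj (d z); first by lia.
have [|c1 c1C c1rk] := @model_rk_surj 0; first by lia.
have [|c2 c2C c2rk] := @model_rk_surj (u x); first by lia.
have [|c3 c3C c3rk] := @model_rk_surj (u p); first by lia.
have indep v : (0 < d v) || (u v < #|C|) -> v \notin C.
  by move=> duv; apply/negP => /(model_junk model); lia.
have [pI qI xI yI zI] : [/\ p \notin C, q \notin C, x \notin C, y \notin C & z \notin C].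
  by split; apply: indep; lia.
(* Here [q], [x], [p] are the vertices [a_1], [a_2], [a_3], and [y], [z] are [b_1], [b_2]. *)
apply: (@model_induced x nbF1 [:: c0; c1; c2; c3] [:: q; x; p; y; z]).
- by rewrite /= !inE !negb_or c1rk c2rk c3rk c0rk; lia.
- by rewrite /= c0C c1C c2C c3C.
- have vs_uniq : uniq [seq (d v, u v) | v <- [:: q; x; p; y; z]].
    by rewrite /= !inE !xpair_eqE; lia.
  exact: map_uniq vs_uniq.
- by rewrite /= pI qI xI yI zI.
- by do 9?case=> //.
rewrite /= c1rk c2rk c3rk c0rk !inE /=.
move: xz zqy zpy yxm => /andP[? ?] /andP[? ?] /andP[? ?] /andP[? ?].
clear pI qI xI yI zI c0C c1C c2C c3C indep.
by congr [:: [:: _; _; _; _; _]; [:: _; _; _; _; _];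
  [:: _; _; _; _; _]; [:: _; _; _; _; _]]; lia.
Qed.
End Obstructions.

(** * Representation number three *)

(** All pairs alternate in a 1-uniform word [w], and still do in [w ++ w]. Excluding 2-uniform words
    thus excludes 1-uniform ones. *)
Lemma representable_1_2 (T : finType) (E : rel T) :
  k_representable E 1 -> k_representable E 2.
Proof.
move=> [w [w1 Ew]]; exists (w ++ w); split; first by move=> x; rewrite count_cat w1.
move=> a b neq_ab; rewrite Ew // /alternate filter_cat.
have w_mem x : x \in w by rewrite -has_pred1 has_count w1.
have w_uniq : uniq w by apply: count_mem_uniq => x; rewrite w1 w_mem.
have : perm_eq [seq x <- w | (x == a) || (x == b)] [:: a; b].
  apply: uniq_perm => [||x]; rewrite ?filter_uniq //= ?inE ?neq_ab //.
  by rewrite mem_filter w_mem andbT.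
move: [seq x <- w | _] => s sE; have := perm_uniq sE; have := perm_size sE.
case: s sE => [|p [|q [|]]] //= _ _; rewrite !inE neq_ab /= !andbT => neq_pq.
by rewrite [q == p]eq_sym neq_pq.
Qed.

Theorem theorem8 (T : finType) (E : rel T)
    (Esym : symmetric E) (Eirr : irreflexive E)
    (Hsplit : is_split E) (Hcomp : is_comparability E) :
  rep_number_is E 3 <-> (has_induced F0 E \/ has_induced F1_5 E).
Proof.
have [C [rk [d [u model]]]] := split_comparability_model Esym Eirr Hsplit Hcomp.
split=> [[_ _ not12] | F0F1]; last first.
  have not2 : ~ k_representable E 2.
    by case: F0F1 => [/F0_not_2representable|/F1_5_not_2representable].
  split=> //; first exact: split_model_3representable model.
  by move=> [|[|[|j]]] // _ /representable_1_2.
have not2 := not12 2 isT.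
case: (boolP [exists x, exists y, exists z, [&& shifted d u x y, shifted d u y z &
                (0 < d x) || (u z < #|C|)]]).
  move=> /existsP[x /existsP[y /existsP[z /and3P[xy yz xz]]]].
  by left; apply: model_F0 model _ _ _ xy yz xz.
move=> noF0; have chain3 x y z : shifted d u x y -> shifted d u y z -> d x = 0 /\ u z = #|C|.
  move=> xy yz; have um := model_u_le model z.
  suff : ~~ ((0 < d x) || (u z < #|C|)) by split; lia.
  apply: contra noF0 => xz; apply/existsP; exists x; apply/existsP; exists y.
  by apply/existsP; exists z; rewrite xy yz.
have [[kap]|[p [q [x [y [z]]]]]] :=
  admissible_or_F1_config (model_u_le model) chain3.
  by move=> /(split_model_2representable model).
by move=> /(model_F1_5 model); right.
Qed.
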